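(* Let $\tilde G:[0,1]\to\mathbb R$ be differentiable and let there exist $0\le L<\infty$ such that $|\tilde G(z)|\le L$ and $|\tilde G'(z)|\le L$ for all $z\in[0,1]$ (so that $|\tilde G(z)-\tilde G(z')|\le L|z-z'|$). Let $$I=\int_{[0,1]}\int_{\mathbb R}\log\left(\frac{1}{\sqrt{2\pi}}\int_{[0,1]}e^{-\frac12\left(\tilde G(y_1)+\varepsilon-\tilde G(x)\right)^2}\mathrm dx\right)\frac{1}{\sqrt{2\pi}}e^{-\frac12\varepsilon^2}\,\mathrm d\varepsilon\,\mathrm dy_1$$ and, for $TOL>0$, $$I^{\mathrm{tr}}=\int_{[0,1]}\int_{-c(TOL)}^{c(TOL)}\log\left(\frac{1}{\sqrt{2\pi}}\int_{[0,1]}e^{-\frac12\left(\tilde G(y_1)+\varepsilon-\tilde G(x)\right)^2}\mathrm dx\right)\frac{1}{\sqrt{2\pi}}e^{-\frac12\varepsilon^2}\,\mathrm d\varepsilon\,\mathrm dy_1,$$ where $c(TOL)=(2(1+p))^{1/2}\log(TOL^{-1})^{1/2}$ for some $p>0$. Then $$|I-I^{\mathrm{tr}}|=o(TOL)\qquad\text{as }TOL\to0.$$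
   Context: This is the nested integral of the expected information gain for one-dimensional parameter and one-dimensional standard normal observation noise ($d_1=2$, $d_2=1$, unit noise covariance); $I^{\mathrm{tr}}$ is obtained by truncating the noise to $[-c(TOL),c(TOL)]$. *)

(* Defs.v *)
From HB Require Import structures.
From mathcomp Require Export all_boot all_order all_algebra.
From mathcomp Require Export all_classical all_reals all_analysis.

Set Implicit Arguments.
Unset Strict Implicit.
Unset Printing Implicit Defensive.

Import Order.TTheory GRing.Theory Num.Theory.
Export numFieldNormedType.Exports.

#[export] Set Implicit Arguments.
#[export] Unset Strict Implicit.
#[export] Unset Printing Implicit Defensive.

#[global] Open Scope classical_set_scope.
#[global] Open Scope ring_scope.

Section nested_integral.
Variable R : realType.
Local Notation mu := (@lebesgue_measure R).

(* [derive1] takes a two-sided limit, which at a boundary point of [A] would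
   constrain [f] outside [A]; here the increment stays in [A]. *)
Definition has_derivative_within (A : set R) (f : R -> R) (z l : R) : Prop :=
  (f w - f z) / (w - z) @[w --> within A z^'] --> l.

Definition std_normal_pdf (e : R) : R :=
  (Num.sqrt (2 * pi))^-1 * expR (- (1 / 2) * e ^+ 2).

Definition log_evidence (G : R -> R) (y e : R) : R :=
  ln ((Num.sqrt (2 * pi))^-1 *
      \int[mu]_(x in `[0, 1]) expR (- (1 / 2) * (G y + e - G x) ^+ 2)).

(* The two outer integrals are kept extended-real valued, so that a divergent
   integral is not silently replaced by a real default value. *)
Definition nested_integral (G : R -> R) (E : set R) : \bar R :=
  (\int[mu]_(y in `[0%R, 1%R]) \int[mu]_(e in E)
     (log_evidence G y e * std_normal_pdf e)%:E)%E.

Definition I_full (G : R -> R) : \bar R := nested_integral G setT.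

Definition cutoff (p TOL : R) : R :=
  Num.sqrt (2 * (1 + p)) * Num.sqrt (ln TOL^-1).

Definition I_tr (G : R -> R) (p TOL : R) : \bar R :=
  nested_integral G `[- cutoff p TOL, cutoff p TOL].

(* [f = o(TOL)] as [TOL] decreases to 0, for an extended-real quantity [f]
   defined for [TOL > 0]; in particular [f TOL] is finite. *)
Definition littleo_TOL (f : R -> \bar R) : Prop :=
  exists r : R -> R,
    (forall TOL, 0 < TOL -> f TOL = (r TOL)%:E) /\
    r =o_ (0^'+) (fun TOL : R => TOL).

End nested_integral.

(* Main.v *)
Require Import Defs.
From mathcomp Require Import measurable_realfun ring lra.

Import Order.TTheory GRing.Theory Num.Theory.

(** Since [(G y + e - G x) ^ 2 <= 2 e ^ 2 + 8 L ^ 2], the evidence (the integral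
    over [x]) lies between [expR (- (e ^ 2 + 4 L ^ 2))] and [1], and the Gaussian
    normalization [1 / sqrt (2 pi)] is below [1].  Hence the log-evidence is
    nonpositive and at most quadratic in [e]: its opposite lies between [0] and
    [A + e ^ 2] with a constant [A] ([log_evidence_bounds]).

    The constant sign makes the whole argument one about nonnegative integrands:
    up to sign, both nested integrals are additive in the domain of the noise
    ([neg_nested_integral_setC]), and once the full one is known to be finite the
    truncation error is, up to sign, the nested integral over the complement of
    [[- c, c]] ([truncation_errorE]).

    To estimate that tail, the quadratic factor is absorbed in the Gaussian at
    the cost of a small [a > 0]: [A + e ^ 2 <= (A + 1 / a) expR (a e ^ 2)]
    ([neg_integrand_le]).  What remains is
    [expR (- (1 / 2 - a) e ^ 2) = expR (- (1 / 2 - 2 a) e ^ 2) expR (- a e ^ 2)].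
    For [|e| >= c] the first factor is at most [expR (- (1 / 2 - 2 a) c ^ 2)],
    which is [TOL ^ ((1 - 4 a) (1 + p))] because
    [c ^ 2 = 2 (1 + p) ln (1 / TOL)]; the second one has a finite integral.  With
    [4 a (1 + p) = p / 2] the exponent of [TOL] is [1 + p / 2]
    ([gaussian_tail_le]), so the error is [O(TOL ^ (1 + p / 2))], which is
    [o(TOL)].

    Being differentiable, [G] is continuous, hence measurable, on [[0, 1]].  Extending [G] by [0]
    changes none of the integrals and yields a bounded measurable function on the
    whole line, for which the parametric integrals are measurable by Tonelli's
    theorem. *)

(** * Measurability and Gaussian integrals *)

Section section_integrals.
Variable R : realType.
Local Notation mu := (@lebesgue_measure R).

(** The difference quotients stay below [|l| + 1] near [z], which makes the
    increment of [f] a multiple of [w - z]. *)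
Lemma has_derivative_within_cvg (A : set R) (f : R -> R) (z l : R) :
  has_derivative_within A f z l -> f w @[w --> within A (nbhs z)] --> f z.
Proof.
move=> /cvgr_dist_le/(_ 1 ltr01) quot_near.
have M_gt0 : 0 < `|l| + 1 by rewrite ltr_wpDl.
apply/cvgrPdist_lt => eps eps_gt0.
have {}quot_near : \forall w \near z, w != z -> A w ->
    `|l - (f w - f z) / (w - z)| <= 1 by exact: quot_near.
rewrite near_withinE; near=> w => Aw.
have [->|w_neq_z] := eqVneq w z; first by rewrite subrr normr0.
have quot_le : `|(f w - f z) / (w - z)| <= `|l| + 1.
  have : `|l - (f w - f z) / (w - z)| <= 1.
    by move: w_neq_z Aw; near: w.
  set q := _ / _ => lq.
  by rewrite -[q](subrK l) addrC (le_trans (ler_normD _ _))// lerD2l distrC.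
have -> : f z - f w = - ((f w - f z) / (w - z) * (w - z)).
  by rewrite divfK ?subr_eq0// opprB.
rewrite normrN normrM (le_lt_trans (ler_wpM2r (normr_ge0 _) quot_le))//.
rewrite mulrC -ltr_pdivlMr// distrC.
by near: w; apply: cvgr_dist_lt; rewrite ?divr_gt0.
Unshelve. all: by end_near. Qed.

(** Tonelli's theorem concerns integrals over a whole space; multiplying by the
    indicator of [E] reduces to that case. *)
Lemma measurable_section_integral d (T : measurableType d)
    (f : T * R -> \bar R) (E : set R) : measurable E ->
  measurable_fun setT f -> (forall z, 0 <= f z)%E ->
  measurable_fun setT (fun t => \int[mu]_(x in E) f (t, x))%E.
Proof.
move=> mE mf f_ge0.
pose fE z := (f z * (\1_E z.2)%:E)%E.
have mfE : measurable_fun setT fE.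
  apply: emeasurable_funM => //.
  by apply/measurable_EFinP; apply: measurableT_comp => //; exact: measurable_indic.
have fE_ge0 z : (0 <= fE z)%E by rewrite mule_ge0// lee_fin.
have := measurable_fun_fubini_tonelli_F (m2 := mu) fE mfE fE_ge0.
congr measurable_fun; apply/funext => t; rewrite /fubini_F.
by rewrite [RHS]integral_mkcond epatch_indic.
Qed.

(** Up to its normalization, the integrand is a centered normal density. *)
Lemma integral_expR_sqr_fin (s : R) : 0 < s ->
  exists2 J : R, 0 <= J &
    (\int[mu]_e (expR (- s * e ^+ 2))%:E = J%:E)%E.
Proof.
move=> s_gt0.
(* the exponent of a normal density is - e ^ 2 / (2 sigma ^ 2) *)
pose sigma := Num.sqrt (2 * s)^-1.
have sigma2 : sigma ^+ 2 = (2 * s)^-1.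
  by rewrite sqr_sqrtr// invr_ge0 mulr_ge0// ltW.
have sigma_neq0 : sigma != 0 by rewrite gt_eqF// sqrtr_gt0 invr_gt0 mulr_gt0.
have peak_gt0 := normal_peak_gt0 sigma_neq0.
exists (normal_peak sigma)^-1; first by rewrite invr_ge0 ltW.
rewrite -[RHS]mule1 -(integral_normal_pdf 0 sigma) -ge0_integralZl//=; last 3 first.
- by apply/measurable_EFinP; exact: measurable_normal_pdf.
- by move=> e _; rewrite lee_fin normal_pdf_ge0.
- by rewrite lee_fin invr_ge0 ltW.
apply: eq_integral => e _; rewrite normal_pdfE// -EFinM mulKf ?gt_eqF//.
congr (expR _)%:E; rewrite subr0 sigma2.
by field; rewrite gt_eqF.
Qed.

End section_integrals.

(** * The nested integral of a bounded measurable model *)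

Section bounded_measurable_model.
Variables (R : realType) (G : R -> R) (L : R).
Hypothesis mG : measurable_fun setT G.
Hypothesis G_bound : forall x, `|G x| <= L.
Local Notation mu := (@lebesgue_measure R).

Lemma integrable_likelihood y e :
  mu.-integrable `[0, 1] (fun x => (expR (- (1 / 2) * (G y + e - G x) ^+ 2))%:E).
Proof.
apply: measurable_bounded_integrable => //.
- by rewrite /= lebesgue_measure_itv/= lte01 oppr0 adde0 ltry.
- apply: measurable_funTS; apply: measurableT_comp => //.
  apply: measurable_funM => //; apply: measurable_funX.
  exact: measurable_funB.
- exists 1; split; first exact: num_real.
  move=> M M_gt1 x _ /=; rewrite ger0_norm ?expR_ge0// (le_trans _ (ltW M_gt1))//.
  by rewrite -expR0 ler_expR mulNr oppr_le0 mulr_ge0 ?sqr_ge0.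
Qed.

Lemma evidence_bounds y e :
  expR (- (e ^+ 2 + 4 * L ^+ 2)) <=
    \int[mu]_(x in `[0, 1]) expR (- (1 / 2) * (G y + e - G x) ^+ 2) <= 1.
Proof.
have int_cst (k : R) : \int[mu]_(x in `[0%R, 1%R]) k = k.
  rewrite (Rintegral_cst _ _ k)//= lebesgue_measure_itv/= lte01 oppr0 adde0.
  by rewrite /= mulr1.
have integrable_cst (k : R) : mu.-integrable `[0, 1] (EFin \o cst k).
  apply: measurable_bounded_integrable => //.
  - by rewrite /= lebesgue_measure_itv/= lte01 oppr0 adde0 ltry.
  - exists `|k|; split; first exact: num_real.
    by move=> M /ltW kM x _.
apply/andP; split.
- rewrite -[leLHS]int_cst; apply: le_Rintegral => //; first exact: integrable_cst.
    exact: integrable_likelihood.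
  move=> x _; rewrite ler_expR.
  have := G_bound x; have := G_bound y; rewrite !ler_norml.
  move: (G x) (G y) => u v /andP[v1 v2] /andP[u1 u2].
  (* (v - u + e) ^ 2 <= 2 e ^ 2 + 2 (v - u) ^ 2, where |v - u| <= 2 L *)
  have vu : (v - u) ^+ 2 <= 4 * L ^+ 2 by nra.
  have := sqr_ge0 (e - (v - u)); nra.
- rewrite -[leRHS](int_cst 1); apply: le_Rintegral => //.
  + exact: integrable_likelihood.
  + exact: integrable_cst.
  + by move=> x _; rewrite -expR0 ler_expR mulNr oppr_le0 mulr_ge0 ?sqr_ge0.
Qed.

(** The upper bound [1] is what gives the log-evidence a constant sign. *)
Lemma normalization_bounds : 0 < (Num.sqrt (2 * pi : R))^-1 <= 1.
Proof.
have pi2 := @pi_ge2 R.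
have tp : 1 <= 2 * pi :> R by lra.
have sqrt_ge1 : 1 <= Num.sqrt (2 * pi) :> R by rewrite -[leLHS]sqrtr1 ler_wsqrtr.
have sqrt_gt0 := lt_le_trans ltr01 sqrt_ge1.
by rewrite invr_gt0 sqrt_gt0 invf_le1.
Qed.

Definition growth_const : R := 4 * L ^+ 2 - ln (Num.sqrt (2 * pi : R))^-1.

Lemma growth_const_ge0 : 0 <= growth_const.
Proof.
have /andP[K_gt0 K_le1] := normalization_bounds.
by rewrite subr_ge0 (le_trans (ln_le0 K_le1))// mulr_ge0 ?sqr_ge0.
Qed.

Lemma log_evidence_bounds y e :
  0 <= - log_evidence G y e <= growth_const + e ^+ 2.
Proof.
rewrite /log_evidence /growth_const.
have /andP[K_gt0 K_le1] := normalization_bounds.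
have /andP[Z_ge Z_le1] := evidence_bounds y e.
set K := _^-1 in K_gt0 K_le1 *; set Z := Rintegral _ _ _ in Z_ge Z_le1 *.
have Z_gt0 : 0 < Z by exact: lt_le_trans (expR_gt0 _) Z_ge.
rewrite oppr_ge0 ln_le0/=; last by rewrite mulr_ile1// ltW.
rewrite lnM ?posrE//.
have : - (e ^+ 2 + 4 * L ^+ 2) <= ln Z by rewrite -ler_expR lnK ?posrE.
lra.
Qed.

(** The evidence is a section integral of a jointly measurable function of
    [((y, e), x)]. *)
Lemma measurable_log_evidence :
  measurable_fun setT (fun z : R * R => log_evidence G z.1 z.2).
Proof.
apply: measurableT_comp; first exact: measurable_ln.
apply: measurable_funM => //; apply: measurableT_comp; first exact: fine_measurable.
pose likelihood (w : (R * R) * R) : \bar R :=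
  (expR (- (1 / 2) * (G w.1.1 + w.1.2 - G w.2) ^+ 2))%:E.
apply: (measurable_section_integral (f := likelihood)) => //.
- apply/measurable_EFinP; apply: measurableT_comp => //.
  apply: measurable_funM => //; apply: measurable_funX.
  apply: measurable_funB; last exact: measurableT_comp.
  apply: measurable_funD.
    by apply: measurableT_comp => //; exact: measurableT_comp.
  exact: measurableT_comp.
- by move=> w; rewrite lee_fin expR_ge0.
Qed.

Lemma measurable_std_normal_pdf : measurable_fun setT (@std_normal_pdf R).
Proof.
apply: measurable_funM => //; apply: measurableT_comp => //.
exact: measurable_funM.
Qed.

Lemma std_normal_pdf_ge0 (e : R) : 0 <= std_normal_pdf e.
Proof. by rewrite mulr_ge0 ?expR_ge0// invr_ge0 sqrtr_ge0. Qed.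

(** The sign is reversed so that the integration theory of nonnegative functions
    applies without integrability side conditions. *)
Definition neg_integrand (z : R * R) : \bar R :=
  (- log_evidence G z.1 z.2 * std_normal_pdf z.2)%:E.

Lemma neg_integrand_ge0 z : (0 <= neg_integrand z)%E.
Proof.
rewrite lee_fin mulr_ge0 ?std_normal_pdf_ge0//.
by have /andP[] := log_evidence_bounds z.1 z.2.
Qed.

Lemma measurable_neg_integrand : measurable_fun setT neg_integrand.
Proof.
apply/measurable_EFinP; apply: measurable_funM.
  by apply: measurableT_comp => //; exact: measurable_log_evidence.
by apply: measurableT_comp => //; exact: measurable_std_normal_pdf.
Qed.

Lemma measurable_neg_integrand_section y :
  measurable_fun setT (fun e => neg_integrand (y, e)).
Proof. by apply: measurableT_comp => //; exact: measurable_neg_integrand. Qed.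

(** The inequality [1 + t <= expR t] at [t = a e ^ 2] bounds both [1] and
    [a e ^ 2] by [expR (a e ^ 2)], so a small part of the Gaussian decay pays for
    the quadratic growth of the log-evidence. *)
Lemma neg_integrand_le a y e : 0 < a ->
  (neg_integrand (y, e) <= ((Num.sqrt (2 * pi))^-1 * (growth_const + a^-1) *
                            expR (- (1 / 2 - a) * e ^+ 2))%:E)%E.
Proof.
move=> a_gt0; rewrite lee_fin /= /std_normal_pdf.
have /andP[_ le_A] := log_evidence_bounds y e.
have /andP[K_gt0 _] := normalization_bounds.
set K := _^-1 in K_gt0 *.
have -> : - (1 / 2 - a) * e ^+ 2 = a * e ^+ 2 + - (1 / 2) * e ^+ 2 by ring.
rewrite expRD mulrCA -!mulrA ler_pM2l// [leRHS]mulrA ler_pM2r ?expR_gt0//.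
apply: le_trans le_A _.
have e2_ge0 := sqr_ge0 e.
have exp_ge := expR_ge1Dx (a * e ^+ 2).
rewrite mulrDl lerD//.
  apply: ler_peMr; first exact: growth_const_ge0.
  by rewrite (le_trans _ exp_ge)// lerDl mulr_ge0// ltW.
by rewrite mulrC ler_pdivlMr// mulrC (le_trans _ exp_ge)// lerDr.
Qed.

Definition neg_nested_integral (E : set R) : \bar R :=
  (\int[mu]_(y in `[0%R, 1%R]) \int[mu]_(e in E) neg_integrand (y, e))%E.

Lemma nested_integralE E : nested_integral G E = (- neg_nested_integral E)%E.
Proof.
rewrite /neg_nested_integral -integral_ge0N; last first.
  by move=> y _; apply: integral_ge0 => e _; exact: neg_integrand_ge0.
apply: eq_integral => y _; rewrite -integral_ge0N => [|e _]; last exact: neg_integrand_ge0.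
by apply: eq_integral => e _; rewrite /neg_integrand -EFinN mulNr opprK.
Qed.

Lemma measurable_inner_integral E : measurable E ->
  measurable_fun setT (fun y => \int[mu]_(e in E) neg_integrand (y, e))%E.
Proof.
move=> mE; apply: measurable_section_integral => //; first exact: measurable_neg_integrand.
exact: neg_integrand_ge0.
Qed.

Lemma neg_nested_integral_ge0 E : (0 <= neg_nested_integral E)%E.
Proof.
by apply: integral_ge0 => y _; apply: integral_ge0 => e _; exact: neg_integrand_ge0.
Qed.

Lemma neg_nested_integral_setC E : measurable E ->
  neg_nested_integral setT = (neg_nested_integral E + neg_nested_integral (~` E))%E.
Proof.
move=> mE; rewrite /neg_nested_integral -ge0_integralD//; first last.
- by apply: measurable_funTS; apply: measurable_inner_integral; exact: measurableC.
- by move=> y _; apply: integral_ge0 => e _; exact: neg_integrand_ge0.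
- by apply: measurable_funTS; exact: measurable_inner_integral.
- by move=> y _; apply: integral_ge0 => e _; exact: neg_integrand_ge0.
apply: eq_integral => y _; rewrite -(setUv E) ge0_integral_setU//.
- exact: measurableC.
- by apply: measurable_funTS; exact: measurable_neg_integrand_section.
- by move=> e _; exact: neg_integrand_ge0.
- exact/disj_setPCl.
Qed.

(** The bound on the integrand does not depend on [y], which ranges over an
    interval of length [1]. *)
Lemma neg_nested_integral_le_gaussian (E : set R) (C s J : R) : measurable E ->
  0 <= C ->
  (\int[mu]_e (expR (- s * e ^+ 2))%:E = J%:E)%E ->
  (forall y e, E e -> neg_integrand (y, e) <= (C * expR (- s * e ^+ 2))%:E)%E ->
  (neg_nested_integral E <= (C * J)%:E)%E.
Proof.
move=> mE C_ge0 intJ le_gauss.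
have mgauss : measurable_fun setT (fun e : R => (expR (- s * e ^+ 2))%:E).
  apply/measurable_EFinP; apply: measurableT_comp => //.
  exact: measurable_funM.
have mCgauss : measurable_fun setT (fun e : R => (C * expR (- s * e ^+ 2))%:E).
  by apply/measurable_EFinP; apply: measurable_funM => //; exact/measurable_EFinP.
have inner_le y : (\int[mu]_(e in E) neg_integrand (y, e) <= (C * J)%:E)%E.
  rewrite EFinM -intJ -ge0_integralZl//.
  pose Cgauss e := (C * expR (- s * e ^+ 2))%:E.
  apply: (@le_trans _ _ (\int[mu]_(e in E) Cgauss e)%E).
  - apply: ge0_le_integral => //.
    + by move=> e _; exact: neg_integrand_ge0.
    + by apply: measurable_funTS; exact: measurable_neg_integrand_section.
    + exact: measurable_funTS.
    + by move=> e Ee; exact: le_gauss.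
  - apply: ge0_subset_integral => // e _.
    by rewrite lee_fin mulr_ge0 ?expR_ge0.
apply: (@le_trans _ _ (\int[mu]_(y in `[0%R, 1%R]) (C * J)%:E)%E).
  apply: ge0_le_integral => //.
  - by move=> y _; apply: integral_ge0 => e _; exact: neg_integrand_ge0.
  - by apply: measurable_funTS; exact: measurable_inner_integral.
by rewrite (integral_cst _ _ (C * J)%:E)//= lebesgue_measure_itv/= lte01 oppr0 adde0 mule1.
Qed.

(** Finiteness of the full integral rules out the indeterminate difference of
    two infinities. *)
Lemma truncation_errorE (c : R) : neg_nested_integral setT \is a fin_num ->
  `|nested_integral G setT - nested_integral G `[(- c)%R, c]|%E =
  neg_nested_integral (~` `[- c, c]).
Proof.
rewrite !nested_integralE (@neg_nested_integral_setC `[- c, c])//.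
set a := neg_nested_integral _; set b := neg_nested_integral _.
rewrite fin_numD => /andP[a_fin b_fin].
rewrite oppeK fin_num_oppeD// addeAC (addeC (- a)%E) subee// add0e abseN gee0_abs//.
exact: neg_nested_integral_ge0.
Qed.

End bounded_measurable_model.

(** * Tail estimates *)

Section tail_estimates.
Variable R : realType.

(** Outside the truncation interval [e ^ 2] is at least the squared cutoff
    [2 (1 + p) ln (1 / TOL)].  The hypothesis on [a] makes
    [(1 / 2 - 2 a) (2 (1 + p))] equal to [1 + p / 2], so the part
    [expR (- (1 / 2 - 2 a) e ^ 2)] of the Gaussian is at most
    [TOL ^ (1 + p / 2)]. *)
Lemma gaussian_tail_le (p a TOL e : R) : 0 < p -> a * (8 * (1 + p)) = p ->
  0 < TOL <= 1 ->
  (~` `[- cutoff p TOL, cutoff p TOL]) e ->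
  expR (- (1 / 2 - a) * e ^+ 2) <=
  TOL * expR (p / 2 * ln TOL) * expR (- a * e ^+ 2).
Proof.
move=> p_gt0 aE /andP[TOL_gt0 TOL_le1] tail_e.
have lnTOL : ln TOL^-1 = - ln TOL by rewrite lnV ?posrE.
have lnTOL_ge0 : 0 <= - ln TOL by rewrite oppr_ge0 ln_le0.
have c2 : cutoff p TOL ^+ 2 = 2 * (1 + p) * - ln TOL.
  rewrite /cutoff exprMn !sqr_sqrtr ?lnTOL//.
  by rewrite mulr_ge0// addr_ge0// ltW.
have c_ge0 : 0 <= cutoff p TOL by rewrite mulr_ge0 ?sqrtr_ge0.
have c_le : cutoff p TOL ^+ 2 <= e ^+ 2.
  rewrite -[leRHS]real_normK ?num_real// ler_sqr ?nnegrE// leNgt.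
  by apply/negP => lt_c; apply: tail_e; rewrite /= in_itv/= -ler_norml ltW.
have coef_ge0 : 0 <= 1 / 2 - 2 * a by nra.
rewrite -{1}[TOL]lnK ?posrE// -!expRD ler_expR.
have := ler_wpM2l coef_ge0 c_le; rewrite c2.
have -> : (1 / 2 - 2 * a) * (2 * (1 + p) * - ln TOL) = - ((1 + p / 2) * ln TOL).
  have -> : (1 / 2 - 2 * a) * (2 * (1 + p) * - ln TOL) =
    - ((1 + p - a * (8 * (1 + p)) / 2) * ln TOL) by field.
  by rewrite aE; field.
lra.
Qed.

(** For positive [t], [expR (q * ln t)] is the power [t ^ q], which tends to [0]
    with [t]. *)
Lemma littleo_of_power_bound (r : R -> R) (B q : R) : 0 < q -> 0 <= B ->
  (forall t, 0 < t <= 1 -> `|r t| <= B * (t * expR (q * ln t))) ->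
  r =o_ (0^'+) (fun t : R => t).
Proof.
move=> q_gt0 B_ge0 r_le; apply/eqoP => eps eps_gt0.
have B1_gt0 : 0 < B + 1 by rewrite ltr_wpDl.
have epsB_gt0 : 0 < eps / (B + 1) by rewrite divr_gt0.
(* t0 = (eps / (B + 1)) ^ (1 / q); B + 1 rather than B, as B may vanish *)
pose t0 := expR (ln (eps / (B + 1)) / q).
near=> t.
have t_gt0 : 0 < t by near: t; exact: nbhs_right_gt.
have t_le1 : t <= 1 by near: t; exact: nbhs_right_le.
have t_le : t <= t0 by near: t; apply: nbhs_right_le; exact: expR_gt0.
have factor_le : expR (q * ln t) <= eps / (B + 1).
  rewrite -[leRHS]lnK ?posrE// ler_expR mulrC -ler_pdivlMr//.
  by rewrite -ler_expR lnK ?posrE.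
apply: le_trans (r_le t _) _; first by rewrite t_gt0.
rewrite (ger0_norm (ltW t_gt0)) mulrCA [leRHS]mulrC ler_pM2l//.
apply: (@le_trans _ _ ((B + 1) * expR (q * ln t))).
  by rewrite ler_pM2r ?expR_gt0// lerDl.
by rewrite mulrC -ler_pdivlMr.
Unshelve. all: by end_near. Qed.

End tail_estimates.

(** * The truncation error *)

(** Two Gaussian bounds on the integrand are used: the exponent [1 / 2 - a] on the
    whole line gives finiteness, and the exponent [a] on the complement of the
    truncation interval leaves the factor [TOL ^ (1 + p / 2)]. *)
Lemma littleo_truncation_error (R : realType) (G : R -> R) (L p : R) :
  measurable_fun setT G -> (forall x, `|G x| <= L) -> 0 < p ->
  littleo_TOL (fun TOL : R => `|I_full G - I_tr G p TOL|%E).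
Proof.
move=> mG G_bound p_gt0.
have p1_gt0 : 0 < 8 * (1 + p) by rewrite mulr_gt0// addr_gt0.
pose a := p / (8 * (1 + p)).
have a_gt0 : 0 < a by rewrite divr_gt0.
have aE : a * (8 * (1 + p)) = p by rewrite divfK// gt_eqF.
have half_gt0 : 0 < 1 / 2 - a by nra.
have [J1 J1_ge0 intJ1] := integral_expR_sqr_fin half_gt0.
have [J2 J2_ge0 intJ2] := integral_expR_sqr_fin a_gt0.
pose C := (Num.sqrt (2 * pi))^-1 * (growth_const L + a^-1).
have C_ge0 : 0 <= C.
  rewrite mulr_ge0 ?invr_ge0 ?sqrtr_ge0// addr_ge0 ?growth_const_ge0//.
  by rewrite invr_ge0 ltW.
have total_fin : neg_nested_integral G setT \is a fin_num.
  rewrite ge0_fin_numE; last exact: (neg_nested_integral_ge0 mG G_bound).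
  apply: le_lt_trans (ltry (C * J1)).
  apply: (neg_nested_integral_le_gaussian mG G_bound _ _ intJ1) => // y e _.
  exact: neg_integrand_le.
have error_ge0 TOL := neg_nested_integral_ge0 mG G_bound (~` `[- cutoff p TOL, cutoff p TOL]).
have error_fin TOL :
    neg_nested_integral G (~` `[- cutoff p TOL, cutoff p TOL]) \is a fin_num.
  move: total_fin; rewrite (@neg_nested_integral_setC _ _ _ mG G_bound
    `[- cutoff p TOL, cutoff p TOL])// fin_numD.
  by case/andP.
exists (fun TOL => fine (neg_nested_integral G (~` `[- cutoff p TOL, cutoff p TOL]))).
split=> [TOL TOL_gt0|].
  by rewrite fineK// (truncation_errorE mG G_bound).
apply: (@littleo_of_power_bound _ _ (C * J2) (p / 2)).
- by rewrite divr_gt0.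
- by rewrite mulr_ge0.
move=> TOL TOL01; have /andP[TOL_gt0 TOL_le1] := TOL01.
rewrite ger0_norm ?fine_ge0// -lee_fin fineK// mulrAC.
apply: (neg_nested_integral_le_gaussian mG G_bound _ _ intJ2).
- exact: measurableC.
- exact: (mulr_ge0 C_ge0 (mulr_ge0 (ltW TOL_gt0) (expR_ge0 _))).
move=> y e tail_e; apply: le_trans (neg_integrand_le mG G_bound y e a_gt0) _.
rewrite lee_fin -/C -(mulrA C) ler_wpM2l//.
exact: gaussian_tail_le.
Qed.

Theorem lemma3 (R : realType) (G dG : R -> R) (L p : R)
  (diffG : forall z, z \in `[0, 1] -> has_derivative_within `[0, 1] G z (dG z))
  (L_ge0 : 0 <= L)
  (G_bound : forall z, z \in `[0, 1] -> `|G z| <= L)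
  (dG_bound : forall z, z \in `[0, 1] -> `|dG z| <= L)
  (p_gt0 : 0 < p) :
  littleo_TOL (fun TOL : R => `|I_full G - I_tr G p TOL|%E).
Proof.
(* G is unconstrained outside [0, 1], where it may fail to be measurable *)
pose g := G \_ `[0, 1].
have gE x : x \in `[0, 1] -> g x = G x.
  by move=> x01; rewrite /g patchE mem_set.
have mg : measurable_fun setT g.
  apply/(measurable_restrictT _ _).1 => //.
  apply: subspace_continuous_measurable_fun => //.
  apply/subspace_continuousP => z z01.
  by apply: has_derivative_within_cvg; exact: diffG.
have g_bound x : `|g x| <= L.
  rewrite /g patchE; case: ifPn => [/set_mem x01|_]; last by rewrite normr0.
  exact: G_bound.
have nestedE E : nested_integral G E = nested_integral g E.
  apply: eq_integral => y /set_mem y01; apply: eq_integral => e _.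
  congr (ln (_ * _) * _)%:E; apply: eq_Rintegral => x /set_mem x01.
  by rewrite !gE.
rewrite /I_full /I_tr; under eq_fun do rewrite !nestedE.
exact: littleo_truncation_error mg g_bound p_gt0.
Qed.
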